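(* Let $G$ be a compact metrisable abelian topological group (written additively), let $(\Omega,\mathcal{F},P)$ be a probability space, and let $X,Y:\Omega\to G$ be independent random variables. Let $A\subset G$ be a subset such that $P(Y\in A)=1$ and $X\sim X+a$ for each $a\in A$. Then $X\sim X+Y$.
   Context: A random variable with values in a topological space $G$ is a map $X:\Omega\to G$ such that $X^{-1}(B)$ is measurable for every Borel set $B\subset G$. Its distribution is the Borel probability measure $\mu_X(B)=P(X\in B)$ on $G$. For $G$-valued random variables $X,Z$, $X\sim Z$ means that they have the same distribution, i.e. $\mu_X=\mu_Z$. The hypothesis $P(Y\in A)=1$ is understood to include that $\{Y\in A\}$ is an event, i.e. belongs to $\mathcal{F}$. *)

(* Defs.v *)
From HB Require Import structures.
From mathcomp Require Import all_boot all_order all_algebra.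
From mathcomp Require Import all_classical all_reals all_analysis.

Set Implicit Arguments.
Unset Strict Implicit.
Unset Printing Implicit Defensive.

Import Order.TTheory GRing.Theory Num.Theory.

Local Open Scope classical_set_scope.
Local Open Scope ring_scope.

Definition metrizable (R : realType) (T : topologicalType) : Prop :=
  exists dist : T -> T -> R,
    [/\ forall x y, 0 <= dist x y,
        forall x y, dist x y = 0 <-> x = y,
        forall x y, dist x y = dist y x,
        forall x y z, dist x z <= dist x y + dist y z &
        forall U : set T, open U <->
          (forall x, U x ->
             exists2 e : R, 0 < e & [set y | dist x y < e] `<=` U)].

(* The Borel space of G: the carrier of G with the sigma-algebra <<s open >>.
   The library's sigma-algebra structure on g_sigma_algebraType asks for a
   pointed carrier, which is provided by 0. *)
Definition borel (G : topologicalZmodType) : Type := G.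
HB.instance Definition _ (G : topologicalZmodType) :=
  Choice.copy (borel G) (G : choiceType).
HB.instance Definition _ (G : topologicalZmodType) :=
  isPointed.Build (borel G) (0 : G).
HB.instance Definition _ (G : topologicalZmodType) :=
  Measurable.copy (borel G)
    (@g_sigma_algebraType (borel G) (@open G : set (set (borel G)))).

Lemma borel_measurableE (G : topologicalZmodType) :
  (measurable : set (set (borel G))) = <<s (@open G) >>.
Proof. by []. Qed.

(* The operations of G are not inherited by the alias borel G, hence the
   casts. *)
Definition rv_translate (G : topologicalZmodType) (Omega : Type)
    (X : Omega -> borel G) (a : G) : Omega -> borel G :=
  fun w => (X w : G) + a.

Definition rv_add (G : topologicalZmodType) (Omega : Type)
    (X Y : Omega -> borel G) : Omega -> borel G :=
  fun w => (X w : G) + (Y w : G).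

(* Measures are compared on Borel sets only: P is a total function on subsets
   of Omega whose values outside the sigma-algebra are unspecified. *)
Definition same_law (d : measure_display) (Omega : measurableType d)
    (R : realType) (P : probability Omega R) (G : topologicalZmodType)
    (X Z : Omega -> borel G) : Prop :=
  forall B : set (borel G), measurable B ->
    pushforward P X B = pushforward P Z B.

Definition independent_rv (d : measure_display) (Omega : measurableType d)
    (R : realType) (P : probability Omega R) (G : topologicalZmodType)
    (X Y : Omega -> borel G) : Prop :=
  forall B C : set (borel G), measurable B -> measurable C ->
    (P (X @^-1` B `&` Y @^-1` C) = P (X @^-1` B) * P (Y @^-1` C))%E.

(* Main.v *)
Require Import Defs.
From HB Require Import structures.
From mathcomp Require Import all_boot all_order all_algebra finmap.
From mathcomp Require Import all_classical all_reals all_analysis.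
From mathcomp Require Import measurable_realfun.

(** The theorem is Fubini's theorem applied to the law of the pair [(Y, X)].
    Independence says that this law is the product of the laws of [Y] and [X],
    so that, for a Borel set [B],

      P (X + Y \in B) = \int P (X + Y w \in B) dP(w),

    where the probability under the integral is that of [X] translated by the
    constant [Y w] ([independent_joint_lawE]). On the almost sure event
    [Y \in A] the integrand is [P (X \in B)] by hypothesis, hence so is the
    integral ([independent_joint_law_as_const]). Integrating over [Omega]
    rather than against the law of [Y] matters: [Y @^-1` A] is an event,
    whereas [A] itself may fail to be Borel.

    The topology of [G] enters only through measurability. The product of two
    copies of the Borel sigma-algebra contains the open sets of [G * G] because
    [G] is second countable ([compact_metrizable_second_countable]): an open
    set of the product is then a countable union of open boxes
    ([open_prod_countable_boxes]). Addition, being continuous, is therefore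
    measurable for that product sigma-algebra ([borel_add_measurable]). *)

Set Implicit Arguments.
Unset Strict Implicit.
Unset Printing Implicit Defensive.

Import Order.TTheory GRing.Theory Num.Theory.

Local Open Scope classical_set_scope.
Local Open Scope ring_scope.

(** * Second countability of compact metrizable spaces *)

(** A space without points is covered by the empty family. Any other can be
    pointed, and on pointed spaces compactness, which is defined by cluster
    points of filters, amounts to the existence of finite subcovers. *)
Lemma compact_finite_subcover (T : topologicalType) (I : choiceType)
    (f : I -> set T) :
    compact [set: T] -> (forall i, open (f i)) -> \bigcup_i f i = [set: T] ->
  exists2 D : set I, finite_set D & \bigcup_(i in D) f i = [set: T].
Proof.
move=> Tcompact f_open f_cover.
have [[x0 _]|T_empty] := pselect (exists x : T, True); last first.
  by exists set0 => //; apply/seteqP; split=> // x _; case: T_empty; exists x.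
pose pT : ptopologicalType := HB.pack T (isPointed.Build T x0).
have : cover_compact [set: pT] by rewrite -compact_cover.
move=> /(_ I setT f (fun i _ => f_open i))[|D _ Dcover].
  by rewrite /cover f_cover.
by exists [set` D]; [exact: finite_fset|apply/seteqP; split].
Qed.

(** A countable basis consists of the balls of radius [1 / (n + 1)] around the
    centers of a finite cover of the space by such balls, for all [n]. *)
Lemma compact_metrizable_second_countable (R : realType) (T : topologicalType) :
  compact [set: T] -> metrizable R T -> @second_countable T.
Proof.
move=> Tcompact [dist [dist_ge0 dist_eq0 distC dist_triangle openP]].
pose B n x : set T := [set y | dist x y < n.+1%:R^-1].
have B_open n x : open (B n x).
  apply/openP => y /= xy.
  exists (n.+1%:R^-1 - dist x y); first by rewrite subr_gt0.
  move=> z /= yz; rewrite /B/= (le_lt_trans (dist_triangle x y z))//.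
  by rewrite -ltrBrDl.
have B_center n x : B n x x.
  by rewrite /B/= (iffRL (dist_eq0 x x) erefl) invr_gt0.
have /choice[D D_cover] n :
    exists D : set T, finite_set D /\ \bigcup_(x in D) B n x = [set: T].
  apply/exists2P; apply: compact_finite_subcover => //.
  by apply/seteqP; split=> // x _; exists x.
exists (\bigcup_n (B n @` D n)); first last.
  split=> [_ [n _ [x _ <-]]//|x U].
  rewrite nbhsE => -[V [V_open Vx] VU].
  have [e e_gt0 eV] := iffLR (openP V) V_open x Vx.
  (* A basic ball of radius less than [e / 2] that contains [x] lies within
     [e] of [x], although [x] need not be its center. *)
  have /ltr_add_invr[n] : 0 < e / 2 by rewrite divr_gt0.
  rewrite add0r => ne.
  have [c Dc cx] : (\bigcup_(c in D n) B n c) x by rewrite (D_cover n).2.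
  exists (B n c); first by split=> //; exists n => //; exists c.
  move=> y cy; apply/VU/eV => /=.
  rewrite (le_lt_trans (dist_triangle x c y))// [e]splitr ltrD//.
    by rewrite distC (lt_trans cx).
  exact: lt_trans ne.
apply: bigcup_countable => // n _.
exact/finite_set_countable/finite_image/(D_cover n).1.
Qed.

(** * Measurability of addition *)

Lemma open_prod_countable_boxes (T U : topologicalType) (S : set (T * U)) :
    @second_countable T -> @second_countable U -> open S ->
  exists2 C : set (set T * set U), countable C &
    (forall c, C c -> open c.1 /\ open c.2) /\
    S = \bigcup_(c in C) (c.1 `*` c.2).
Proof.
move=> [BT BT_countable [BT_open BTP]] [BU BU_countable [BU_open BUP]] S_open.
exists ((BT `*` BU) `&` [set c | c.1 `*` c.2 `<=` S]).
  apply: (sub_countable (subset_card_le (@subIsetl _ _ _))).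
  exact: countableX.
split=> [c [[/BT_open ? /BU_open ?] _]//|].
apply/seteqP; split=> [[x y] Sxy|z [c [_ cS] cz]]; last exact: cS.
have [[V W] /= [/BTP[V' [BV' V'x] V'V] /BUP[W' [BW' W'y] W'W]] VWS] :
    nbhs (x, y) S by exact: open_nbhs_nbhs.
exists (V', W') => //; split=> //= -[x' y'] /= [? ?].
by apply: VWS; split; [exact: V'V|exact: W'W].
Qed.

(** The sigma-algebra on the domain is the product of the Borel
    sigma-algebras. In general it may be smaller than the Borel sigma-algebra of
    [G * G], for which continuity alone would make addition measurable; second
    countability makes the two agree on open sets. *)
Lemma borel_add_measurable (G : topologicalZmodType) :
    @second_countable G ->
  measurable_fun [set: borel G * borel G]
    (fun z => ((z.1 : G) + (z.2 : G)) : borel G).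
Proof.
move=> G_sc; apply: (measurability _ (borel_measurableE G)).
move=> _ [V V_open <-]; rewrite setTI.
have : open ((fun z : G * G => z.1 + z.2) @^-1` V).
  by apply: open_comp => // z _; exact: add_continuous.
move=> /(open_prod_countable_boxes G_sc G_sc)[C C_countable [C_open ->]].
rewrite bigcup_set_type; apply: countable_bigcupT_measurable.
  by rewrite (eq_countable (card_setT _)).
move=> c; have [c1 c2] := C_open _ (set_valP c).
by apply: measurableX; rewrite borel_measurableE; exact: sub_gen_smallest.
Qed.

(** * The joint law of independent random variables *)

(** The integrand is the conditional probability of [E] once the value of [U]
    is frozen: independence identifies the law of the pair with the product of
    the marginals, since a finite product measure is determined by its values
    on rectangles, and Fubini computes the product measure section by
    section. *)
Lemma independent_joint_lawE (R : realType) (d d1 d2 : measure_display)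
    (Omega : measurableType d) (T1 : measurableType d1) (T2 : measurableType d2)
    (P : probability Omega R) (U : {RV P >-> T1}) (V : {RV P >-> T2}) :
    (forall B C, measurable B -> measurable C ->
      P (U @^-1` B `&` V @^-1` C) = P (U @^-1` B) * P (V @^-1` C))%E ->
  forall E : set (T1 * T2), measurable E ->
  (P ((fun w => (U w, V w)) @^-1` E) =
   \int[P]_w P (V @^-1` xsection E (U w)))%E.
Proof.
move=> UV_indep E mE.
have mUV : measurable_fun setT (fun w => (U w, V w)).
  exact: measurable_fun_pair.
pose UV : {RV P >-> (T1 * T2)%type} :=
  HB.pack (fun w => (U w, V w)) (isMeasurableFun.Build _ _ _ _ _ mUV).
rewrite -[LHS]/(distribution P UV E).
rewrite -(product_measure_unique (m1 := distribution P U)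
  (m2 := distribution P V))//.
rewrite /product_measure1 ge0_integral_distribution//.
exact: measurable_fun_xsection.
Qed.

(** The event [S] lives in [Omega], so that the condition on the values of [U]
    may be given by a set that is not measurable in [T1], as long as its
    preimage contains [S]. *)
Lemma independent_joint_law_as_const (R : realType)
    (d d1 d2 : measure_display) (Omega : measurableType d)
    (T1 : measurableType d1) (T2 : measurableType d2) (P : probability Omega R)
    (U : {RV P >-> T1}) (V : {RV P >-> T2}) (E : set (T1 * T2)) (S : set Omega)
    (c : \bar R) :
    (forall B C, measurable B -> measurable C ->
      P (U @^-1` B `&` V @^-1` C) = P (U @^-1` B) * P (V @^-1` C))%E ->
    measurable E -> measurable S -> P S = 1%E ->
    (forall w, S w -> P (V @^-1` xsection E (U w)) = c) ->
  P ((fun w => (U w, V w)) @^-1` E) = c.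
Proof.
move=> UV_indep mE mS PS1 section_c.
have [w0 Sw0] : S !=set0.
  apply/set0P/eqP => S0; move/eqP: PS1.
  by rewrite S0 measure0 eqe eq_sym oner_eq0.
have c_ge0 : (0 <= c)%E by rewrite -(section_c _ Sw0) measure_ge0.
have PSC0 : P (~` S) = 0%E by rewrite probability_setC// PS1 subee.
rewrite (independent_joint_lawE UV_indep mE).
transitivity (\int[P]_w cst c w)%E.
  apply: ge0_ae_eq_integral => //.
    have mphi := measurable_fun_xsection (distribution P V) mE.
    exact: measurableT_comp mphi (measurable_funPT U).
  exists (~` S); split; first exact: measurableC.
    exact: PSC0.
  by move=> w /= h Sw; apply: h => _; exact: section_c.
rewrite integral_cst// -[RHS]mule1; congr (_ * _)%E.
exact: probability_setT.
Qed.

Theorem theorem14 (R : realType) (G : topologicalZmodType)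
    (G_compact : compact [set: G]) (G_metrizable : metrizable R G)
    (d : measure_display) (Omega : measurableType d) (P : probability Omega R)
    (X Y : {RV P >-> borel G}) (XY_indep : independent_rv P X Y)
    (A : set G)
    (YA_event : measurable (Y @^-1` A)) (YA_as : P (Y @^-1` A) = 1%E)
    (X_translate : forall a : G, A a -> same_law P X (rv_translate X a)) :
  measurable_fun [set: Omega] (rv_add X Y) /\ same_law P X (rv_add X Y).
Proof.
have G_sc := compact_metrizable_second_countable G_compact G_metrizable.
have madd := borel_add_measurable G_sc.
split.
  apply: (measurableT_comp madd (g := fun w => (X w, Y w))).
  exact: measurable_fun_pair.
move=> B mB; rewrite /pushforward.
(* [Y] is the first component, as it is the variable to be frozen; the sum is
   still written as [X + Y], to match the translates in the hypothesis. *)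
pose E : set (borel G * borel G) := [set z | B ((z.2 : G) + (z.1 : G))].
have mE : measurable E.
  have := measurableT_comp madd (@measurable_swap _ _ (borel G) (borel G)).
  by move=> /(_ measurableT B mB); rewrite setTI.
symmetry; apply: (independent_joint_law_as_const (U := Y) (E := E) _ mE
  YA_event YA_as) => [B' C mB' mC|w Aw].
  by rewrite setIC XY_indep// muleC.
rewrite [RHS](X_translate _ Aw B mB) /pushforward; congr (P _).
by apply/seteqP; split=> w' /=; rewrite /xsection/= inE.
Qed.
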